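(* Let $\Omega\subset\mathbb{R}^n$ ($n\ge 2$) be a domain, let $u$ and $v$ be harmonic functions in $\Omega$ with $v$ not identically zero and $Z(u)\supset Z(v)$, and let $f$ be the real analytic function in $\Omega$ such that $u=fv$. Then $f$ satisfies the maximum and minimum principles: for any subdomain $O\Subset\Omega$, \[ \max_{\partial O} f=\max_{\overline{O}} f \quad\text{and}\quad \min_{\partial O} f=\min_{\overline{O}} f . \]
   Context: All functions are real-valued, and $Z(g)=\{x\in\Omega: g(x)=0\}$. A real analytic $f$ in $\Omega$ with $u=fv$ exists whenever $Z(v)\subset Z(u)$, and it is unique when $v$ is not identically zero. $O\Subset\Omega$ means that $\overline{O}$ is a compact subset of $\Omega$. *)

(* Defs.v *)
From HB Require Import structures.
From mathcomp Require Import all_boot all_order all_algebra finmap.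
From mathcomp Require Import all_classical all_reals all_analysis.
(* Not imported: its [summable] clashes with the one of [esum]. *)
From mathcomp Require summability.

Set Implicit Arguments.
Unset Strict Implicit.
Unset Printing Implicit Defensive.

Import Order.TTheory GRing.Theory Num.Theory.
Import numFieldNormedType.Exports.

Local Open Scope classical_set_scope.
Local Open Scope ring_scope.

(* Functions on an open set D of R^n are represented by total functions
   'rV[R]_n -> R; every predicate below that takes D depends only on their
   restriction to D (for the ones involving derivatives: as D is open). *)

Definition domain (T : topologicalType) (D : set T) : Prop :=
  [/\ open D, connected D & D !=set0].

Definition boundary (T : topologicalType) (A : set T) : set T :=
  closure A `\` A°.

Definition compactly_contained (T : topologicalType) (A B : set T) : Prop :=
  compact (closure A) /\ closure A `<=` B.

Definition zero_set (T : Type) (R : nmodType) (D : set T) (g : T -> R) : set T :=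
  [set x | D x /\ g x = 0].

Section Rn.
Variables (R : realType) (n : nat).
Implicit Types (D : set 'rV[R]_n) (g : 'rV[R]_n -> R).

Definition pderivable (i : 'I_n) g (x : 'rV[R]_n) : Prop :=
  derivable g x (delta_mx 0 i).

Definition pderive (i : 'I_n) g : 'rV[R]_n -> R := 'D_(delta_mx 0 i) g.

Fixpoint Ck (k : nat) D g : Prop :=
  (forall x, D x -> {for x, continuous g}) /\
  if k is k'.+1 then
    forall i, (forall x, D x -> pderivable i g x) /\ Ck k' D (pderive i g)
  else True.

Definition laplacian g (x : 'rV[R]_n) : R :=
  \sum_(i < n) pderive i (pderive i g) x.

Definition is_harmonic D g : Prop :=
  Ck 2 D g /\ forall x, D x -> laplacian g x = 0.

Definition monomial (al : {ffun 'I_n -> nat}) (x : 'rV[R]_n) : R :=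
  \prod_(i < n) x ord0 i ^+ al i.

(* The sum of the power series is unordered (limit of the partial sums along
   the directed set of finite sets of multi-indices), which for real series is
   the same as absolute convergence. *)
Definition real_analytic D g : Prop :=
  forall a, D a -> exists c : {ffun 'I_n -> nat} -> R,
    \forall x \near a,
      summability.partial_sum (fun al => c al * monomial al (x - a))
        @ summability.totally --> g x.

End Rn.

Section Extrema.
Variables (T : Type) (R : realType).
Implicit Types (f : T -> R) (A : set T) (m : R).

Definition is_max_on f A m : Prop := (f @` A) m /\ ubound (f @` A) m.
Definition is_min_on f A m : Prop := (f @` A) m /\ lbound (f @` A) m.

End Extrema.

(* Main.v *)
Require Import Defs.
From HB Require Import structures.
From mathcomp Require Import all_boot all_order all_algebra finmap.
From mathcomp Require Import all_classical all_reals all_analysis.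
From mathcomp Require Import ring lra.

(* Let c bound f on the boundary of O. The function w = u - c v = (f - c) v is
   harmonic and vanishes on the boundary of {x in O | f x > c}, so the maximum
   principle for harmonic functions gives w = 0, hence v = 0, on this open set.
   If it were nonempty, unique continuation would give v = 0 on Omega. Thus
   f <= c on O. The minimum is the case of -f and -u.

   Unique continuation is obtained from the maximum principle alone. A barrier
   argument bounds the increments of a harmonic function by its supremum on a
   slightly larger cube. Finite differences of harmonic functions are harmonic,
   so iterating yields |Delta_a^k v| <= (C k |a| / r)^k sup |v|. If v = 0 near z,
   the low-order differences at z vanish, and Newton's formula shows that v
   vanishes on a ball around z of twice the radius, up to a definite fraction of
   the distance to the boundary. *)

Import Order.TTheory GRing.Theory Num.Theory.
Import numFieldNormedType.Exports.

Local Open Scope classical_set_scope.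
Local Open Scope ring_scope.

(** * Harmonicity through second differences *)

Lemma is_derive_line {R : realType} {n : nat} (g : 'rV[R]_n -> R) (x v : 'rV[R]_n) (t : R) :
  derivable g (x + t *: v) v ->
  is_derive t 1 (fun s => g (x + s *: v)) ('D_v g (x + t *: v)).
Proof.
move=> dg.
have E : (fun h : R => h^-1 *: (((fun s => g (x + s *: v)) \o shift t) (h *: (1 : R))
             - g (x + t *: v))) =
         (fun h => h^-1 *: ((g \o shift (x + t *: v)) (h *: v) - g (x + t *: v))).
  apply/funext => h /=; congr (_ *: (g _ - _)).
  by rewrite -[h *: 1]/(h * 1) mulr1 scalerDl addrCA.
by split; rewrite ?/derivable ?/derive E.
Qed.

(** Apply the mean value theorem once to the symmetrised remainder [F]. Its derivative is a
    difference of two first-order remainders of [dphi] at 0, so differentiability of [dphi] at the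
    single point 0 suffices. *)
Lemma symmetric_taylor2 {R : realType} (phi : R -> R) (dphi : R -> R) (l : R) :
  (\forall t \near (0 : R), is_derive (t : R) (1 : R) phi (dphi t)) ->
  is_derive (0 : R) (1 : R) dphi l ->
  forall e, 0 < e ->
  \forall h \near (0 : R), `|phi h + phi (- h) - 2 * phi 0 - l * h ^+ 2| <= e * h ^+ 2.
Proof.
move=> dphiP [ddphi <-] e e0; set l' := 'D_1 dphi 0.
have e20 : 0 < e / 2 by lra.
have := derivable_nbhs ddphi; move/eqaddoP => /(_ _ e20) near2.
have [d /= d0 dP] : exists2 d : R, 0 < d & forall t, `|t| < d ->
    is_derive (t : R) (1 : R) phi (dphi t) /\ `|dphi t - dphi 0 - l' * t| <= e / 2 * `|t|.
  have [d /= d0 dP] := filterI dphiP near2.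
  exists d => // t td; have [|? H] := dP t; first by rewrite /= sub0r normrN.
  split=> //; suff <- : ((fun h : R => (dphi \o shift 0) (h *: (1 : R))) -
      (cst (dphi 0) + *:%R^~ ('D_1 dphi 0))) t = dphi t - dphi 0 - l' * t by [].
  rewrite /= !fctE /= addr0 -[t *: (1 : R)]/(t * 1) mulr1 opprD addrA.
  by rewrite -[t *: 'D_1 dphi 0]/(t * l') [t * _]mulrC.
have key h : 0 < h -> h < d ->
    `|phi h + phi (- h) - 2 * phi 0 - l' * h ^+ 2| <= e * h ^+ 2.
  move=> h0 hd.
  pose F t := phi t + phi (- t) - l' * t ^+ 2.
  pose dF t := dphi t - dphi (- t) - 2 * l' * t.
  have dFP t : `|t| < d -> is_derive (t : R) (1 : R) F (dF t).
    move=> td; have [D1 _] := dP _ td; have [|D2 _] := dP (- t); first by rewrite normrN.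
    have D3 : is_derive (t : R) (1 : R) (phi \o -%R) (dphi (- t) * - 1).
      by apply: is_derive1_comp; exact: is_deriveNid.
    rewrite /F /dF.
    apply: is_derive_eq; rewrite /GRing.scale /=; ring.
  have [c] : exists2 c, c \in `]0, h[%R & F h - F 0 = dF c * (h - 0).
    apply: MVT => //.
      by move=> t; rewrite in_itv /= => /andP[t0 th]; apply: dFP; rewrite gtr0_norm //; lra.
    apply: derivable_within_continuous => t; rewrite in_itv /= => /andP[t0 th].
    by have [|//] := dFP t; rewrite ger0_norm //; lra.
  rewrite in_itv /= => /andP[c0 ch] FE.
  have cd : `|c| < d by rewrite gtr0_norm //; lra.
  have [_ H1] := dP _ cd; have [|_ H2] := dP (- c); first by rewrite normrN.
  have -> : phi h + phi (- h) - 2 * phi 0 - l' * h ^+ 2 = dF c * h.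
    by move: FE; rewrite subr0 => <-; rewrite /F oppr0; ring.
  rewrite normrM (gtr0_norm h0) expr2 mulrA ler_pM2r //.
  rewrite normrN (gtr0_norm c0) in H2; rewrite (gtr0_norm c0) in H1.
  (* The term [- dphi 0] cancels between the remainders at [c] and [- c]; each is at most
     [e / 2 * c], and [c < h]. *)
  have : `|dF c| <= e / 2 * c + e / 2 * c.
    have -> : dF c = (dphi c - dphi 0 - l' * c) - (dphi (- c) - dphi 0 - l' * - c).
      by rewrite /dF; ring.
    by rewrite (le_trans (ler_normB _ _)) // lerD.
  nra.
exists d => // h; rewrite /= sub0r normrN => hd.
have [h0|h0|<-] := ltgtP 0 h.
- by apply: key => //; rewrite gtr0_norm in hd.
- have := key (- h); rewrite opprK sqrrN [phi (- h) + _]addrC; apply; first by lra.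
  by rewrite ltr0_norm in hd.
- by rewrite oppr0 expr0n /= !mulr0 subr0 (_ : _ - _ = 0) ?normr0 //; ring.
Qed.

Section HarmonicAt.
Context {R : realType} {n : nat}.
Implicit Types (g : 'rV[R]_n -> R) (x y a : 'rV[R]_n) (h : R).

Lemma near_lines (P : set 'rV[R]_n) x : (\forall y \near x, P y) ->
  \forall h \near (0 : R), forall i, P (x + h *: delta_mx 0 i).
Proof.
move=> Px; apply: (@filter_forall _ _ _ (nbhs (0 : R)) (nbhs_filter _)) => i.
have cl : {for (0 : R), continuous (fun t : R => x + t *: (delta_mx 0 i : 'rV[R]_n))}.
  apply: cvgD; first exact: cvg_cst.
  by apply: cvgZr_tmp; exact: cvg_id.
by apply: cl; rewrite /= scale0r addr0.
Qed.

Lemma near_linesN (P : set 'rV[R]_n) x : (\forall y \near x, P y) ->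
  \forall h \near (0 : R), forall i, P (x - h *: delta_mx 0 i).
Proof.
move=> /near_lines[d d0 dP]; exists d => // h /= hd i.
by rewrite -scaleNr; apply: dP; move: hd; rewrite /= !sub0r !normrN.
Qed.

(* Harmonicity is used only through second differences: unlike a condition on
   derivatives, [harmonic_at] passes trivially to translates, reflections and
   finite differences. *)
Definition sum_second_diff g x h : R :=
  \sum_(i < n) (g (x + h *: delta_mx 0 i) + g (x - h *: delta_mx 0 i) - 2 * g x).

Definition harmonic_at g x : Prop :=
  {for x, continuous g} /\
  forall e, 0 < e -> \forall h \near (0 : R), `|sum_second_diff g x h| <= e * h ^+ 2.

Lemma is_harmonic_at (D : set 'rV[R]_n) g x :
  open D -> is_harmonic D g -> D x -> harmonic_at g x.
Proof.
move=> oD [[cg dg] lapg] Dx; split; first exact: cg.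
move=> e e0.
pose phi i (t : R) := g (x + t *: delta_mx 0 i).
pose l i := pderive i (pderive i g) x.
(* Each axis gets the share [e / (n + 1)], a denominator that is positive even for [n = 0]. The
   quadratic terms [l i] add up to the Laplacian, which is 0. *)
have n0 : 0 < (n%:R + 1 : R) by rewrite ltr_wpDl.
have tay i : \forall h \near (0 : R),
    `|phi i h + phi i (- h) - 2 * phi i 0 - l i * h ^+ 2| <= e / (n%:R + 1) * h ^+ 2.
  have [d1 [_ /(_ i) [d2 _]]] := dg i.
  apply: (@symmetric_taylor2 _ _ (fun t => pderive i g (x + t *: delta_mx 0 i)));
    last by rewrite divr_gt0.
    have : \forall t \near (0 : R), forall j, D (x + t *: delta_mx 0 j).
      by apply: near_lines; exact: open_nbhs_nbhs.
    apply: filterS => t Dt; apply: is_derive_line; exact: d1 (Dt i).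
  have := @is_derive_line _ _ (pderive i g) x (delta_mx 0 i) 0.
  by rewrite scale0r addr0; apply; exact: d2.
have : \forall h \near (0 : R), forall i,
    `|phi i h + phi i (- h) - 2 * phi i 0 - l i * h ^+ 2| <= e / (n%:R + 1) * h ^+ 2.
  exact: (@filter_forall _ _ _ (nbhs (0 : R)) (nbhs_filter _) tay).
apply: filterS => h hP.
have -> : sum_second_diff g x h =
    \sum_(i < n) (phi i h + phi i (- h) - 2 * phi i 0 - l i * h ^+ 2).
  have lap0 : \sum_(i < n) l i = 0 := lapg x Dx.
  rewrite [RHS]sumrB -mulr_suml lap0 mul0r subr0.
  by apply: eq_bigr => i _; rewrite /phi scale0r addr0 scaleNr.
rewrite (le_trans (ler_norm_sum _ _ _)) // (le_trans (ler_sum _ (fun i _ => hP i))) //.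
rewrite sumr_const card_ord -[leLHS]mulr_natl mulrA; apply: ler_wpM2r; first exact: sqr_ge0.
by rewrite mulrCA ger_pMr // ler_pdivrMr // mul1r; lra.
Qed.

(** * The maximum principle *)

Lemma harmonic_at_near g1 g2 x :
  (\forall y \near x, g1 y = g2 y) -> harmonic_at g1 x -> harmonic_at g2 x.
Proof.
move=> g12 [cg hg]; split.
  have g12x : g1 x = g2 x := nbhs_singleton g12.
  rewrite /prop_for /continuous_at -g12x; apply: cvg_trans cg.
  exact: (near_eq_cvg g12).
move=> e e0; near=> h.
suff <- : sum_second_diff g1 x h = sum_second_diff g2 x h.
  by near: h; exact: hg.
rewrite /sum_second_diff (nbhs_singleton g12).
apply: eq_bigr => i _; congr (_ + _ - _).
- by move: i; near: h; exact: near_lines _ _ g12.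
- by move: i; near: h; exact: near_linesN _ _ g12.
Unshelve. all: by end_near. Qed.

Lemma harmonic_at_lin (k1 k2 : R) g1 g2 x : harmonic_at g1 x -> harmonic_at g2 x ->
  harmonic_at (fun y => k1 * g1 y + k2 * g2 y) x.
Proof.
move=> [c1 h1] [c2 h2]; split.
  by apply: continuousD; apply: continuousM => //; exact: cst_continuous.
move=> e e0.
have p1 : 0 < `|k1| + `|k2| + 1 by rewrite ltr_wpDl // addr_ge0.
have e'0 : 0 < e / (`|k1| + `|k2| + 1) by rewrite divr_gt0.
near=> h.
have -> : sum_second_diff (fun y => k1 * g1 y + k2 * g2 y) x h =
    k1 * sum_second_diff g1 x h + k2 * sum_second_diff g2 x h.
  by rewrite /sum_second_diff !mulr_sumr -big_split; apply: eq_bigr => i _ /=; ring.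
have H1 : `|sum_second_diff g1 x h| <= e / (`|k1| + `|k2| + 1) * h ^+ 2.
  by near: h; exact: h1.
have H2 : `|sum_second_diff g2 x h| <= e / (`|k1| + `|k2| + 1) * h ^+ 2.
  by near: h; exact: h2.
rewrite (le_trans (ler_normD _ _)) // !normrM.
rewrite (le_trans (lerD (ler_wpM2l _ H1) (ler_wpM2l _ H2))) //.
rewrite -mulrDl mulrA; apply: ler_wpM2r; first exact: sqr_ge0.
by rewrite mulrCA ger_pMr // ler_pdivrMr // mul1r lerDl.
Unshelve. all: by end_near. Qed.

Lemma harmonic_at_shift g x a : harmonic_at g (x + a) -> harmonic_at (fun y => g (y + a)) x.
Proof.
move=> [cg hg]; split.
  apply: (@continuous_comp _ _ _ (fun y => y + a) g) => //.
  by apply: continuousD; [exact: cvg_id|exact: cst_continuous].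
move=> e /hg; apply: filterS => h.
suff -> : sum_second_diff (fun y => g (y + a)) x h = sum_second_diff g (x + a) h by [].
by apply: eq_bigr => i _; rewrite !(addrAC x _ a).
Qed.

(** The Euclidean square is introduced separately because the norm of ['rV[R]_n] is the sup norm,
    whose balls are cubes. *)
Definition sqnorm y : R := \sum_i y ord0 i ^+ 2.

Lemma sum_continuous (I : finType) (F : I -> 'rV[R]_n -> R) :
  (forall i, continuous (F i)) -> continuous (fun y => \sum_i F i y).
Proof.
move=> cF; rewrite (_ : (fun y => _) = \sum_i F i); last first.
  by apply/funext => y; rewrite fct_sumE.
elim/big_ind: _ => [|f g cf cg y|i _]; [exact: cst_continuous| |exact: cF].
by apply: continuousD; [exact: cf|exact: cg].
Qed.

Lemma sqnorm_continuous : continuous sqnorm.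
Proof.
apply: sum_continuous => i y; rewrite /continuous_at expr2.
by apply: continuousM; exact: coord_continuous.
Qed.

Lemma sqnorm_axis y h i :
  sqnorm (y + h *: delta_mx 0 i) = sqnorm y + 2 * h * y ord0 i + h ^+ 2.
Proof.
rewrite /sqnorm (bigD1 i) //= [in RHS](bigD1 i) //= !mxE !eqxx mulr1.
rewrite (eq_bigr (fun j => y ord0 j ^+ 2)); first by ring.
by move=> j ji; rewrite !mxE eqxx (negbTE ji) /= mulr0 addr0.
Qed.

Lemma sum_second_diff_sqnorm y h : sum_second_diff sqnorm y h = 2 * n%:R * h ^+ 2.
Proof.
rewrite /sum_second_diff (eq_bigr (fun=> 2 * h ^+ 2)).
  by rewrite sumr_const card_ord -mulr_natr; ring.
by move=> i _; rewrite -scaleNr !sqnorm_axis; ring.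
Qed.

(* A positive maximum of [phi] persists after adding a small multiple of
   [sqnorm], whose second differences are positive. *)
Lemma harmonic_max_principle (K : set 'rV[R]_n) (phi : 'rV[R]_n -> R) : (0 < n)%N ->
  compact K -> (forall y, K y -> {for y, continuous phi}) ->
  (forall y, K y -> phi y <= 0 \/ (nbhs y K /\ harmonic_at phi y)) ->
  forall y, K y -> phi y <= 0.
Proof.
move=> n0 cK cphi hphi y0 Ky0; rewrite leNgt; apply/negP => phi0.
have K0 : K !=set0 by exists y0.
have [c Kc qc] : exists2 c, c \in K & forall t, t \in K -> sqnorm t <= sqnorm c.
  by apply: EVT_max_rV => //; apply: continuous_subspaceT; exact: sqnorm_continuous.
have q0 y : 0 <= sqnorm y by apply: sumr_ge0 => i _; exact: sqr_ge0.
have B0 : 0 < sqnorm c + 1 by rewrite ltr_wpDl.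
(* So small that [e * sqnorm] stays below [phi y0] on [K]; hence [phi] is still positive at the
   maximum point [y1] of [Phi], which excludes the first alternative of [hphi] there. *)
pose e := phi y0 / (sqnorm c + 1).
have e0 : 0 < e by rewrite divr_gt0.
have eB : e * sqnorm c < phi y0.
  by rewrite /e mulrAC ltr_pdivrMr // ltr_pM2l // ltrDl.
pose Phi y := phi y + e * sqnorm y.
have cPhi y : K y -> {for y, continuous Phi}.
  move=> Ky; apply: continuousD; first exact: cphi.
  by apply: continuousM; [exact: cst_continuous|exact: sqnorm_continuous].
have [y1 /set_mem Ky1 my1] : exists2 c, c \in K & forall t, t \in K -> Phi t <= Phi c.
  apply: EVT_max_rV => //; apply: continuous_in_subspaceT => y /set_mem Ky; exact: cPhi.
have phi1 : 0 < phi y1.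
  have := my1 _ (mem_set Ky0); have := qc _ (mem_set Ky1); have := q0 y0.
  rewrite /Phi => h1 h2 h3.
  have := ler_wpM2l (ltW e0) h2; have := mulr_ge0 (ltW e0) h1; lra.
have [|[nK [_ /(_ _ e0) hy1]]] := hphi _ Ky1; first by rewrite leNgt phi1.
have [d /= d0 dP] := filterI hy1 (filterI (near_lines _ _ nK) (near_linesN _ _ nK)).
have [|H1 [H2 H3]] := dP (d / 2).
  by rewrite /= sub0r normrN gtr0_norm; lra.
(* With [h = d / 2], the maximum makes this sum nonpositive, whereas harmonicity of [phi] bounds it
   below by [(2 * n - 1) * e * h ^+ 2 > 0]. *)
have : sum_second_diff Phi y1 (d / 2) <= 0.
  apply: sumr_le0 => i _.
  have := my1 _ (mem_set (H2 i)); have := my1 _ (mem_set (H3 i)); lra.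
have -> : sum_second_diff Phi y1 (d / 2) =
    sum_second_diff phi y1 (d / 2) + e * sum_second_diff sqnorm y1 (d / 2).
  rewrite /sum_second_diff mulr_sumr -big_split /=; apply: eq_bigr => i _.
  by rewrite /Phi; ring.
rewrite sum_second_diff_sqnorm.
move: H1; rewrite ler_norml => /andP[H1 _].
have n1 : 1 <= n%:R :> R by rewrite ler1n.
have d2 : 0 < e * (d / 2) ^+ 2 by rewrite mulr_gt0 // exprn_gt0 //; lra.
have : e * (d / 2) ^+ 2 * 1 <= e * (d / 2) ^+ 2 * n%:R by rewrite ler_pM2l.
rewrite (_ : e * (2 * n%:R * (d / 2) ^+ 2) = 2 * (e * (d / 2) ^+ 2 * n%:R)); last by ring.
lra.
Qed.

(** * Increments of harmonic functions *)

Lemma rV_norm_le x (d : R) : 0 <= d -> (`|x| <= d) <-> (forall j, `|x ord0 j| <= d).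
Proof.
move=> d0; split=> [xd j|xd].
  by apply: le_trans xd; rewrite [leRHS]/Num.Def.normr /= mx_normrE;
     apply/bigmax_geP; right; exists (ord0, j).
rewrite [leLHS]/Num.Def.normr /= mx_normrE; apply: bigmax_le => // -[i j] _ /=.
by rewrite ord1.
Qed.

Definition reflect_axis (p : 'rV[R]_n) (i : 'I_n) y : 'rV[R]_n :=
  y + (2 * (p ord0 i - y ord0 i)) *: delta_mx 0 i.

Lemma reflect_axisE p i y j :
  reflect_axis p i y ord0 j = if j == i then 2 * p ord0 i - y ord0 i else y ord0 j.
Proof.
by rewrite !mxE eqxx; case: eqP => [->|_] /=; rewrite ?mulr1 ?mulr0 ?addr0 //; ring.
Qed.

Lemma reflect_axisD p i y h j : reflect_axis p i (y + h *: delta_mx 0 j) =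
  reflect_axis p i y + (if j == i then - h else h) *: delta_mx 0 j.
Proof.
apply/rowP => k; rewrite !mxE !eqxx /=.
have [->|ki] := eqVneq k i; last first.
  by rewrite /= !mulr0 !addr0; case: (eqVneq j i) => [->|] //; rewrite (negbTE ki) !mulr0.
by rewrite [i == j]eq_sym; case: eqVneq => _ /=; ring.
Qed.

Lemma harmonic_at_reflect g p i x :
  harmonic_at g (reflect_axis p i x) -> harmonic_at (g \o reflect_axis p i) x.
Proof.
move=> [cg hg]; split.
  apply: continuous_comp => //; rewrite /reflect_axis.
  have cs : {for x, continuous (fun y => 2 * (p ord0 i - y ord0 i))}.
    apply: continuousM; first exact: cst_continuous.
    by apply: continuousB; [exact: cst_continuous|exact: coord_continuous].
  by apply: continuousD; [exact: cvg_id|exact: continuousZr_tmp].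
move=> e /hg; apply: filterS => h.
suff -> : sum_second_diff (g \o reflect_axis p i) x h =
    sum_second_diff g (reflect_axis p i x) h by [].
apply: eq_bigr => j _ /=; rewrite -!scaleNr !reflect_axisD.
by case: eqP => // _; rewrite opprK [g _ + g _]addrC.
Qed.

(* The barrier of Gilbarg and Trudinger, Theorem 3.9: it is harmonic, vanishes
   at [p], is nonnegative on the half cube [0 <= y_i - p_i <= d] and at least
   [d ^+ 2] on the faces of that half cube other than [y_i = p_i]. *)
Definition barrier p (d : R) (i : 'I_n) y : R :=
  sqnorm (y - p) + n%:R * ((y ord0 i - p ord0 i) * (d - (y ord0 i - p ord0 i))).

(** Exact cancellation: [sqnorm] contributes [2 * n * h ^+ 2], and the concave quadratic in the
    coordinate [i] contributes the opposite, along axis [i] alone. *)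
Lemma barrier_harmonic p d i x : harmonic_at (barrier p d i) x.
Proof.
split.
  apply: continuousD.
    apply: (@continuous_comp _ _ _ (fun y => y - p) sqnorm); last exact: sqnorm_continuous.
    by apply: continuousB; [exact: cvg_id|exact: cst_continuous].
  have cw : {for x, continuous (fun y => y ord0 i - p ord0 i)}.
    by apply: continuousB; [exact: coord_continuous|exact: cst_continuous].
  apply: continuousM; first exact: cst_continuous.
  apply: continuousM => //.
  by apply: continuousB => //; exact: cst_continuous.
move=> e e0; exists 1; [exact: ltr01|move=> h _].
suff -> : sum_second_diff (barrier p d i) x h = 0.
  by rewrite normr0 mulr_ge0 ?sqr_ge0 // ltW.
have -> : sum_second_diff (barrier p d i) x h = sum_second_diff sqnorm (x - p) h
    - n%:R * \sum_(j < n) 2 * (h * (j == i)%:R) ^+ 2.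
  rewrite /sum_second_diff [n%:R * _]mulr_sumr -sumrB; apply: eq_bigr => j _.
  rewrite /barrier !(addrAC x _ (- p)) !mxE eqxx [i == j]eq_sym /=.
  have E (a b q N w k : R) : a + N * ((w + k) * (d - (w + k))) + (b + N * ((w - k) * (d - (w - k))))
      - 2 * (q + N * (w * (d - w))) = a + b - 2 * q - N * (2 * k ^+ 2) by ring.
  by rewrite !(addrAC (x ord0 i) _ (- p ord0 i)); exact: E.
rewrite sum_second_diff_sqnorm (bigD1 i) //= eqxx mulr1 big1 => [|j /negbTE ->]; first by ring.
by rewrite /= mulr0 expr0n /= mulr0.
Qed.

(** The difference of [g] and its reflection in [y_i = p_i] is harmonic, vanishes on that hyperplane
    and is at most [2 * S]. The maximum principle on a half cube puts it below a multiple of the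
    barrier, which grows only linearly in [s] along the axis. *)
Lemma axis_diff_le g p (d S s : R) i :
  0 < d -> (forall y, `|y - p| <= d -> harmonic_at g y /\ `|g y| <= S) -> 0 <= s <= d ->
  g (p + s *: delta_mx 0 i) - g (p - s *: delta_mx 0 i) <= 2 * S * n%:R * s / d.
Proof.
move=> d0 hg /andP[s0 sd].
have n0 : (0 < n)%N by apply: leq_ltn_trans (ltn_ord i).
have n1 : 1 <= n%:R :> R by rewrite ler1n.
have S0 : 0 <= S.
  by have [|_] := hg p; [rewrite subrr normr0 ltW|exact: le_trans].
pose lo j := if j == i then p ord0 i else p ord0 j - d.
pose K := [set y : 'rV[R]_n | forall j, `[lo j, p ord0 j + d]%classic (y ord0 j)].
have cK : compact K by exact (rV_compact (fun j => @segment_compact _ (lo j) (p ord0 j + d))).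
have Kd y : K y -> `|y - p| <= d.
  move=> Ky; apply: (proj2 (rV_norm_le _ _ (ltW d0))) => j.
  have := Ky j; rewrite !mxE /lo /= in_itv /= ler_norml; case: eqP => [->|_] /andP[]; lra.
have Kr y : K y -> `|reflect_axis p i y - p| <= d.
  move=> /Kd /(proj1 (rV_norm_le _ _ (ltW d0))) yd; apply: (proj2 (rV_norm_le _ _ (ltW d0))) => j.
  rewrite mxE [(- p) _ _]mxE reflect_axisE; have := yd j; rewrite !mxE.
  by case: eqP => [->|_] //; rewrite !ler_norml => /andP[]; lra.
(* Scaled so that [c * d ^+ 2 = 2 * S]: on the outer faces, where the barrier is at least [d ^+ 2],
   it dominates the difference of two values of [g]. *)
pose c := 2 * S / d ^+ 2.
have c0 : 0 <= c by rewrite divr_ge0 ?sqr_ge0 // mulr_ge0.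
pose phi y := 1 * (1 * g y + -1 * (g \o reflect_axis p i) y) + - c * barrier p d i y.
have hphi y : K y -> harmonic_at phi y.
  move=> Ky; apply: harmonic_at_lin; last exact: barrier_harmonic.
  apply: harmonic_at_lin; first by have [] := hg _ (Kd _ Ky).
  by apply: harmonic_at_reflect; have [] := hg _ (Kr _ Ky).
have phi_le0 y : K y -> phi y <= 0.
  apply: harmonic_max_principle => // z Kz; first by have [] := hphi _ Kz.
  have zi : 0 <= z ord0 i - p ord0 i <= d.
    by have := Kz i; rewrite /lo eqxx /= in_itv /= => /andP[]; lra.
  have b0 : 0 <= n%:R * ((z ord0 i - p ord0 i) * (d - (z ord0 i - p ord0 i))).
    by case/andP: zi => z1 z2; rewrite mulr_ge0 // mulr_ge0 //; lra.
  have face j : (z - p) ord0 j ^+ 2 = d ^+ 2 -> phi z <= 0.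
    move=> zj; have [_] := hg _ (Kd _ Kz); have [_] := hg _ (Kr _ Kz).
    rewrite !ler_norml => /andP[g1 _] /andP[_ g2].
    suff : 2 * S <= c * barrier p d i z by rewrite /phi /=; lra.
    rewrite -[leLHS](@divfK _ (d ^+ 2)) ?gt_eqF ?exprn_gt0 //.
    rewrite -/c ler_wpM2l // /barrier -[leLHS]addr0 lerD //.
    by rewrite -zj /sqnorm (bigD1 j) //= lerDl sumr_ge0 // => k _; exact: sqr_ge0.
  (* Three cases: on the symmetry face the reflection fixes [z]; on an outer face [face] applies;
     any other point is interior to [K]. *)
  have [zpi|zpi] := eqVneq (z ord0 i) (p ord0 i).
    left; have -> : phi z = - c * sqnorm (z - p).
      rewrite /phi /= /barrier /reflect_axis zpi subrr mulr0 scale0r addr0; ring.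
    by rewrite mulNr oppr_le0 mulr_ge0 // sumr_ge0 // => k _; exact: sqr_ge0.
  have [[j zj]|nj] := pselect (exists j, `|(z - p) ord0 j| = d).
    by left; apply: (face j); rewrite -zj real_normK ?num_real.
  right; split; last exact: hphi.
  apply: (@filter_forall _ _ _ (nbhs z) (nbhs_filter _)) => j.
  apply: (@coord_continuous _ _ _ ord0 j z (`[lo j, p ord0 j + d]%classic)).
  have zlo : lo j < z ord0 j.
    have := Kz j; rewrite /= in_itv /= => /andP[]; rewrite le_eqVlt => /orP[/eqP lz _|//].
    exfalso; move: lz; rewrite /lo; case: eqP => [->|_] lz; first by rewrite lz eqxx in zpi.
    apply: nj; exists j; rewrite !mxE -lz (_ : _ - _ = - d); last by ring.
    by rewrite normrN gtr0_norm.
  have zhi : z ord0 j < p ord0 j + d.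
    have := Kz j; rewrite /= in_itv /= => /andP[_]; rewrite le_eqVlt => /orP[/eqP hz|//].
    exfalso; apply: nj; exists j; rewrite !mxE hz (_ : _ - _ = d); last by ring.
    by rewrite gtr0_norm.
  have : z ord0 j \in `]lo j, p ord0 j + d[ by rewrite in_itv /= zlo.
  by move=> /near_in_itvoo; apply: filterS => t; exact: subset_itv_oo_cc.
have Ks : K (p + s *: delta_mx 0 i).
  move=> j; rewrite /lo /= in_itv /= !mxE eqxx /=.
  by case: eqP => [->|_] /=; rewrite ?mulr1 ?mulr0; apply/andP; split; lra.
have := phi_le0 _ Ks; rewrite /phi /=.
have -> : reflect_axis p i (p + s *: delta_mx 0 i) = p - s *: delta_mx 0 i.
  apply/rowP => j; rewrite reflect_axisE !mxE !eqxx /=.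
  by case: eqP => [->|_] /=; rewrite ?mulr1 ?mulr0 ?oppr0 //; ring.
suff : c * barrier p d i (p + s *: delta_mx 0 i) <= 2 * S * n%:R * s / d by lra.
have -> : 2 * S * n%:R * s / d = c * (n%:R * s * d).
  rewrite /c; field; exact: lt0r_neq0.
apply: ler_wpM2l => //.
rewrite /barrier addrAC subrr add0r.
have -> : sqnorm (s *: delta_mx 0 i) = s ^+ 2.
  by rewrite -[X in sqnorm X]add0r sqnorm_axis /sqnorm big1
    ?mxE ?mulr0 ?add0r // => k _; rewrite mxE expr0n.
(* On the axis the barrier is [s ^+ 2 + n * s * (d - s)], at most [n * s * d] since [n >= 1]. *)
rewrite !mxE !eqxx /= mulr1 (addrAC (p _ _)) subrr add0r.
have := ler_wpM2r (sqr_ge0 s) n1; rewrite mul1r; nra.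
Qed.

Lemma axis_diff_norm_le g p (d S s : R) i :
  0 < d -> (forall y, `|y - p| <= d -> harmonic_at g y /\ `|g y| <= S) -> `|s| <= d ->
  `|g (p + s *: delta_mx 0 i) - g (p - s *: delta_mx 0 i)| <= 2 * S * n%:R * `|s| / d.
Proof.
move=> d0 hg; wlog s0 : s / 0 <= s => [H|].
  have [|/ltW s0] := leP 0 s; first exact: H.
  have := H (- s); rewrite !scaleNr opprK normrN distrC; apply; lra.
rewrite ger0_norm // => sd; rewrite ler_norml lerNl opprB.
apply/andP; split; last by apply: axis_diff_le => //; rewrite s0.
have hNg y : `|y - p| <= d -> harmonic_at (fun t => 0 * g t + -1 * g t) y /\
    `|0 * g y + -1 * g y| <= S.
  move=> /hg[h1 h2]; split; first exact: harmonic_at_lin.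
  by rewrite mul0r add0r mulN1r normrN.
have := axis_diff_le _ _ _ _ s i d0 hNg; rewrite s0 sd => /(_ isT).
lra.
Qed.

Definition harmonic_bounded g (z : 'rV[R]_n) (r S : R) : Prop :=
  forall y, `|y - z| <= r -> harmonic_at g y /\ `|g y| <= S.

Lemma harmonic_bounded_sub g z r S z' r' :
  harmonic_bounded g z r S -> `|z' - z| + r' <= r -> harmonic_bounded g z' r' S.
Proof.
move=> hg zr y yz; apply: hg; apply: le_trans zr.
by rewrite (le_trans (ler_distD z' _ _)) // addrC lerD2l.
Qed.

(** Walk from [p] to [p + a] one coordinate at a time. Each of the [n] steps is a symmetric
    difference about its midpoint, which lies within [|a|] of [p], and costs at most
    [n * |a| / d * S]. *)
Lemma vector_diff_le g p a (d S : R) : 0 < d -> `|a| <= d ->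
  harmonic_bounded g p (`|a| + d) S -> `|g (p + a) - g p| <= n%:R ^+ 2 * `|a| / d * S.
Proof.
move=> d0 ad hg.
have S0 : 0 <= S.
  have [|_] := hg p; first by rewrite subrr normr0 addr_ge0 // ltW.
  exact: le_trans.
have aj j : `|a ord0 j| <= `|a| by apply: (proj1 (rV_norm_le _ _ _)).
pose q k : 'rV[R]_n := \row_j (p ord0 j + (if (j < k)%N then a ord0 j else 0)).
have key k : (k <= n)%N -> `|g (q k) - g p| <= k%:R * (n%:R * `|a| / d * S).
  elim: k => [_|k IH kn].
    rewrite mul0r (_ : q 0%N = p) ?subrr ?normr0 //.
    by apply/rowP => j; rewrite !mxE addr0.
  pose i := Ordinal kn.
  pose s := a ord0 i / 2; pose c := q k + s *: delta_mx 0 i.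
  have qk : q k = c - s *: delta_mx 0 i by rewrite /c addrK.
  have qk1 : q k.+1 = c + s *: delta_mx 0 i.
    apply/rowP => j; rewrite !mxE eqxx /= ltnS leq_eqVlt -[j == k :> nat]/(j == i).
    have [->|_] := eqVneq j i; last by rewrite /= mulr0 !addr0.
    by rewrite ltnn /= mulr1 addr0 -addrA -splitr.
  have hc : harmonic_bounded g c d S.
    apply: harmonic_bounded_sub hg _; rewrite lerD2r.
    apply: (proj2 (rV_norm_le _ _ (normr_ge0 a))) => j; rewrite !mxE eqxx /=.
    have [->|_] := eqVneq j i; last first.
      by rewrite mulr0 addr0 addrAC subrr add0r; case: ifP; rewrite ?normr0.
    rewrite ltnn addr0 addrAC subrr add0r mulr1 /s normrM.
    by rewrite (le_trans _ (aj i)) // ler_piMr // gtr0_norm; lra.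
  have sa : `|s| <= `|a| / 2 by rewrite normrM [X in _ * X]gtr0_norm // ler_pM2r.
  have a0 := normr_ge0 a.
  have := axis_diff_norm_le g c d S s i d0 hc; rewrite -qk -qk1 => step.
  have {step} : `|g (q k.+1) - g (q k)| <= n%:R * `|a| / d * S.
    apply: le_trans (step _) _; first by lra.
    rewrite (_ : 2 * S * n%:R * `|s| / d = (n%:R / d * S) * (2 * `|s|)); last by ring.
    rewrite (_ : n%:R * `|a| / d * S = (n%:R / d * S) * `|a|); last by ring.
    by apply: ler_wpM2l; [rewrite mulr_ge0 // divr_ge0 // ltW|lra].
  have {IH} := IH (ltnW kn).
  rewrite (_ : g (q k.+1) - g p = (g (q k.+1) - g (q k)) + (g (q k) - g p)); last by ring.
  rewrite -[k.+1%:R]natr1 mulrDl mul1r => h1 h2.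
  by rewrite (le_trans (ler_normD _ _)) // addrC lerD.
have := key n (leqnn n).
have -> : q n = p + a by apply/rowP => j; rewrite !mxE ltn_ord.
move/le_trans; apply.
by rewrite !mulrA -expr2.
Qed.

Fixpoint finite_diff a (k : nat) g : 'rV[R]_n -> R :=
  if k is k'.+1 then fun y => finite_diff a k' g (y + a) - finite_diff a k' g y else g.

(* Working with differences rather than derivatives avoids proving first that
   harmonic functions are smooth. *)
Lemma finite_diff_bounded g z a (d S r : R) k : 0 < d -> `|a| <= d ->
  harmonic_bounded g z (r + k%:R * (`|a| + d)) S ->
  harmonic_bounded (finite_diff a k g) z r ((n%:R ^+ 2 * `|a| / d) ^+ k * S).
Proof.
move=> d0 ad; elim: k r => [|k IH] r; first by rewrite mul0r addr0 expr0 mul1r.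
rewrite -natr1 mulrDl mul1r [_ * _ + _]addrC addrA => /IH hg y yz.
(* Every difference uses up [|a| + d] of the radius: [|a|] to reach the shifted point and [d] for
   the increment estimate. *)
have yb : harmonic_bounded (finite_diff a k g) y (`|a| + d)
    ((n%:R ^+ 2 * `|a| / d) ^+ k * S).
  by apply: harmonic_bounded_sub hg _; rewrite lerD2r.
split; last first.
  by rewrite exprS -mulrA; exact: vector_diff_le.
rewrite /= (_ : (fun t => _) = (fun t => 1 * finite_diff a k g (t + a) + -1 * finite_diff a k g t)).
  apply: harmonic_at_lin.
    apply: harmonic_at_shift; have [|//] := yb (y + a).
    by rewrite addrAC subrr add0r lerDl ltW.
  by have [|//] := yb y; rewrite subrr normr0 addr_ge0 // ltW.
by apply/funext => t; ring.
Qed.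

(* Newton's forward formula, in the form of the recursion
   [Delta^j g (y + a) = Delta^j g y + Delta^(j+1) g y]. *)
Lemma newton_bound g z a (B : R) m :
  (forall i, (i <= m)%N -> g (z + i%:R *: a) = 0) ->
  (forall j, (m < j <= 2 * m)%N -> `|finite_diff a j g z| <= B) ->
  0 <= B -> `|g (z + (2 * m)%:R *: a)| <= 2 ^+ (2 * m) * B.
Proof.
move=> g0 gB B0; pose F i j := finite_diff a j g (z + i%:R *: a).
have FS i j : F i.+1 j = F i j + F i j.+1.
  by rewrite /F /= [RHS]addrC subrK -natr1 scalerDl scale1r addrA.
(* The [m + 1] zero nodes annihilate a whole triangle of the difference table, in particular all
   differences at [z] of order at most [m]. *)
have F0 j : forall i, (i + j <= m)%N -> F i j = 0.
  elim: j => [|j IH] i; first by rewrite addn0; exact: g0.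
  rewrite addnS => ij; have := FS i j.
  by rewrite (IH i) ?(ltnW ij) // (IH i.+1) // add0r.
have FB i : forall j, (i + j <= 2 * m)%N -> `|F i j| <= 2 ^+ i * B.
  elim: i => [|i IH] j ij.
    rewrite expr0 mul1r; have [jm|mj] := leqP j m; first by rewrite F0 ?normr0.
    by rewrite /F scale0r addr0; apply: gB; rewrite mj.
  rewrite FS (le_trans (ler_normD _ _)) // exprS -mulrA mulr2n mulrDl mul1r lerD //.
    by apply: IH; apply: leq_trans ij; rewrite addSn.
  by apply: IH; rewrite addnS -addSn.
by have := FB (2 * m)%N 0%N; rewrite addn0; apply.
Qed.

Lemma geometric_squeeze (y c S : R) : 0 <= c < 1 ->
  (forall m, `|y| <= c ^+ m.+1 * S) -> y = 0.
Proof.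
move=> /andP[c0 c1] hy; apply/normr0_eq0/eqP; rewrite eq_le normr_ge0 andbT.
have H : (fun m => c ^+ m.+1 * S) @ \oo --> (0 : R).
  rewrite -[X in _ --> X](mul0r S); apply: cvgM; last exact: cvg_cst.
  by rewrite (cvg_shiftS (fun m => c ^+ m)); apply: cvg_expr; rewrite ger0_norm.
by apply: (cvgr_to_ge H); exact: nearW.
Qed.

(** * Unique continuation *)

(** Cut the segment from [z] to [x] into [2 * m] steps: the nodes up to [m] lie in the zero ball, so
    only differences of order above [m] contribute. They are at most [q ^+ m * S], and the Newton
    factor [4 ^+ m] is absorbed because [4 * q < 1], which is the role of the constant 16. Then let
    [m] grow. *)
Lemma zero_ball_double g z (r S d : R) : (0 < n)%N -> harmonic_bounded g z r S ->
  16 * n%:R ^+ 2 * d < r -> (forall y, `|y - z| < d -> g y = 0) ->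
  forall x, `|x - z| < 2 * d -> g x = 0.
Proof.
move=> n0 hg dr g0 x xd.
have n1 : 1 <= n%:R ^+ 2 :> R by rewrite -natrX ler1n expn_gt0 n0.
have d0 : 0 < d by have := le_lt_trans (normr_ge0 _) xd; lra.
have dr4 : 16 * d < r.
  by apply: le_lt_trans dr; rewrite -mulrA ler_pM2l // ler_peMl // ltW.
have r0 : 0 < r by lra.
have S0 : 0 <= S by have [|_] := hg z; [rewrite subrr normr0 ltW|exact: le_trans].
pose q := 4 * n%:R ^+ 2 * d / r.
have q0 : 0 <= q by rewrite divr_ge0 ?ltW // mulr_gt0 // mulr_gt0 //; lra.
have q41 : 4 * q < 1.
  by rewrite /q mulrA ltr_pdivrMr // mul1r; move: dr; congr (_ < _); ring.
have q1 : q <= 1 by lra.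
apply: (geometric_squeeze _ (4 * q) S) => [|k]; first by rewrite mulr_ge0.
set m := k.+1.
have m0 : 0 < m%:R :> R by rewrite ltr0n.
have mm0 : 0 < (2 * m)%:R :> R by rewrite ltr0n muln_gt0.
pose a := (2 * m)%:R^-1 *: (x - z).
(* Up to [2 * m] differences use the radius [2 * m * (|a| + D) = |x - z| + r / 2], which is below
   [r]. As [D] shrinks like [|a|], the ratio [n ^+ 2 * |a| / D] stays below [q] for all [m]. *)
pose D := r / (4 * m%:R).
have D0 : 0 < D by rewrite divr_gt0 // mulr_gt0.
have aE : (2 * m)%:R * `|a| = `|x - z|.
  by rewrite normrZ gtr0_norm ?invr_gt0 // mulVKf // gt_eqF.
have mDE : m%:R * D = r / 4 by rewrite /D; field; rewrite gt_eqF.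
have maE : m%:R * `|a| = `|x - z| / 2 by rewrite -aE natrM; field.
have aD : `|a| <= D by rewrite -(ler_pM2l m0) maE mDE; lra.
have -> : x = z + (2 * m)%:R *: a.
  by rewrite scalerA divff ?gt_eqF // scale1r addrC subrK.
have -> : (4 * q) ^+ m * S = 2 ^+ (2 * m) * (q ^+ m * S).
  by rewrite exprM mulrA -exprMn (_ : 2 ^+ 2 = 4 :> R) //; ring.
apply: newton_bound; last by rewrite mulr_ge0 // exprn_ge0.
  move=> i im; apply: g0; rewrite addrAC subrr add0r normrZ ger0_norm //.
  apply: (@le_lt_trans _ _ (m%:R * `|a|)); first by rewrite ler_wpM2r // ler_nat.
  by rewrite maE; lra.
move=> j /andP[mj j2m].
have jb : harmonic_bounded g z (0 + j%:R * (`|a| + D)) S.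
  apply: harmonic_bounded_sub hg _; rewrite subrr normr0 !add0r.
  apply: (@le_trans _ _ ((2 * m)%:R * (`|a| + D))).
    by rewrite ler_wpM2r ?ler_nat // addr_ge0 // ltW.
  by rewrite mulrDr aE natrM -mulrA mDE; lra.
have [|_ /le_trans] := finite_diff_bounded _ _ _ _ _ _ _ D0 aD jb z.
  by rewrite subrr normr0.
apply; apply: ler_wpM2r => //.
have Qq : n%:R ^+ 2 * `|a| / D <= q.
  rewrite ler_pdivrMr // /q (_ : 4 * n%:R ^+ 2 * d / r * D = n%:R ^+ 2 * (d / m%:R)); last first.
    by rewrite /D; field; rewrite !gt_eqF.
  apply: ler_wpM2l; first exact: sqr_ge0.
  by rewrite ler_pdivlMr // mulrC maE; lra.
apply: (@le_trans _ _ (q ^+ j)).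
  by apply: lerXn2r => //; rewrite nnegrE // divr_ge0 ?(ltW D0) // mulr_ge0 // sqr_ge0.
by apply: ler_wiXn2l => //; exact: ltnW.
Qed.

Lemma compact_norm_ball z (r : R) : compact [set y : 'rV[R]_n | `|y - z| <= r].
Proof.
apply: bounded_closed_compact.
  exists (`|z| + r); split; first exact: num_real.
  move=> M hM y /= yr; have := ler_distD z y 0; rewrite !subr0; lra.
rewrite (_ : [set y | _] = (fun y : 'rV[R]_n => `|y - z|) @^-1` [set t | t <= r]) //.
apply: closed_comp; last exact: closed_le.
move=> y _; apply: (@continuous_comp _ _ _ (fun y => y - z) (fun t => `|t|)).
  by apply: continuousB; [exact: cvg_id|exact: cst_continuous].
exact: norm_continuous.
Qed.

Lemma harmonic_bounded_near (Omega : set 'rV[R]_n) g y :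
  open Omega -> (forall x, Omega x -> harmonic_at g x) -> Omega y ->
  exists r S, 0 < r /\ harmonic_bounded g y (2 * r) S.
Proof.
move=> oO hg Oy; have [d /= d0 dO] := proj1 (nbhs_ballP _ _) (open_nbhs_nbhs (conj oO Oy)).
have KO x : `|x - y| <= 2 * (d / 4) -> Omega x.
  by move=> xd; apply: dO; rewrite -ball_normE /= distrC; lra.
have [||c Kc hc] := @EVT_max_rV _ _ (fun x => `|g x|) [set x : 'rV[R]_n | `|x - y| <= 2 * (d / 4)] _
    (compact_norm_ball _ _).
- by exists y; rewrite /= subrr normr0; lra.
- apply: continuous_in_subspaceT => x /set_mem /KO /hg[cg _].
  by apply: (@continuous_comp _ _ _ g (fun t => `|t|)) => //; exact: norm_continuous.
exists (d / 4), `|g c|; split; first by lra.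
by move=> x xd; split; [apply: hg; exact: KO|apply: hc; exact: mem_set].
Qed.

(* Vanishing spreads from an arbitrarily small ball around [z] to a ball whose
   radius only depends on the distance to the boundary of [Omega]. *)
Lemma harmonic_unique_continuation (Omega : set 'rV[R]_n) g x0 :
  (0 < n)%N -> open Omega -> connected Omega ->
  (forall x, Omega x -> harmonic_at g x) -> Omega x0 -> (\forall y \near x0, g y = 0) ->
  forall x, Omega x -> g x = 0.
Proof.
move=> n0 oO cO hg Ox0 gx0.
pose C := [set x : 'rV[R]_n | \forall y \near x, g y = 0].
have ballP (z : 'rV[R]_n) (r : R) : 0 < r -> (forall y, `|y - z| < r -> g y = 0) -> C z.
  move=> r0 H; apply/nbhs_ballP; exists r => // y; rewrite -ball_normE /= distrC; exact: H.
have oC : open C by exact: open_interior.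
have clC y : Omega y -> closure C y -> C y.
  move=> Oy cy; have [r [S [r0 hb]]] := harmonic_bounded_near _ _ _ oO hg Oy.
  have n1 : 1 <= n%:R ^+ 2 :> R by rewrite -natrX ler1n expn_gt0 n0.
  (* The final radius around [z]: doubling up to [k] requires only [8 * n ^+ 2 * k = r / 4 < r].
     Since [z] is within [k / 2] of [y], the ball of radius [k] around [z] contains that of radius
     [k / 2] around [y]. *)
  pose k := r / (32 * n%:R ^+ 2).
  have k0 : 0 < k by rewrite divr_gt0 // mulr_gt0 //; lra.
  have kE : 32 * n%:R ^+ 2 * k = r by rewrite /k; field; rewrite pnatr_eq0 -lt0n.
  have [z [Cz yz]] : C `&` ball y (k / 2) !=set0.
    by apply: cy; apply: nbhsx_ballx; rewrite divr_gt0.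
  rewrite -ball_normE /= in yz.
  have kr : k <= r by rewrite -kE ler_peMl ?(ltW k0) //; lra.
  have hz : harmonic_bounded g z r S.
    by apply: harmonic_bounded_sub hb _; rewrite distrC; lra.
  have [d /= d0 dz] := proj1 (nbhs_ballP _ _) Cz.
  (* Doubling [i] times from the unknown radius [d], capped at [k] so that the hypothesis of
     [zero_ball_double] persists. *)
  have grow i : forall t, t <= 2 ^+ i * d -> t <= k -> forall x, `|x - z| < t -> g x = 0.
    elim: i => [|i IH] t td tk.
      by move=> x xt; apply: dz; rewrite -ball_normE /= distrC; move: td; rewrite mul1r; lra.
    have t2 : t / 2 <= 2 ^+ i * d by move: td; rewrite exprS; lra.
    have tk2 : t / 2 <= k by lra.
    have := @zero_ball_double g z r S (t / 2) n0 hz _ (IH _ t2 tk2).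
    rewrite (_ : 2 * (t / 2) = t); last by field.
    apply; apply: (@le_lt_trans _ _ (8 * n%:R ^+ 2 * k)); last by lra.
    rewrite (_ : 16 * n%:R ^+ 2 * (t / 2) = 8 * n%:R ^+ 2 * t); last by field.
    by rewrite ler_wpM2l //; lra.
  have [i ik] : exists i, k <= 2 ^+ i * d.
    exists (Num.bound (k / d)); rewrite -ler_pdivrMr //.
    have kd : 0 <= k / d by rewrite divr_ge0 // ltW.
    apply: ltW; apply: lt_le_trans (archi_boundP kd) _.
    by rewrite -natrX ler_nat ltnW // ltn_expl.
  apply: (ballP _ (k / 2)) => [|x xk]; first by lra.
  apply: (grow _ _ ik (lexx _)).
  by have := ler_distD y x z; lra.
(* Connectedness: the set where [g] vanishes locally is nonempty, open and relatively closed in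
   [Omega]. *)
have OC : Omega `&` C = Omega.
  apply: cO; [by exists x0|by exists C|].
  exists (closure C); first exact: closed_closure.
  by apply/seteqP; split=> x [Ox Cx]; split=> //; [exact: subset_closure|exact: clC].
by move=> x; rewrite -OC => -[_]; exact: nbhs_singleton.
Qed.

End HarmonicAt.

(** * Continuity of real analytic functions *)

Lemma unordered_sum_dist {R : realType} {I : choiceType} (T : I -> R) (L e : R) :
  summability.partial_sum T @ summability.totally --> L -> 0 < e ->
  exists A : {fset I}, forall B : {fset I}, (A `<=` B)%fset -> `|L - \sum_(i <- B) T i| < e.
Proof.
move=> cT e0; have FF := @summability.totally_filter I.
have [A _ hA] := proj1 (cvgrPdist_lt _ _) cT e e0.
by exists A => B AB; have := hA B AB; rewrite /summability.partial_sum big_seq_fsetE.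
Qed.

Lemma fset_sum_subset {R : realType} {I : choiceType} (A B : {fset I}) (F : I -> R) :
  (A `<=` B)%fset -> \sum_(i <- A) F i = \sum_(i <- B) (if i \in A then F i else 0).
Proof.
move=> AB; rewrite -(big_fset_incl _ AB) => [|i _ /negbTE -> //].
by apply: eq_big_seq => i ->.
Qed.

(* Unordered convergence is absolute: the bound comes from comparing the sum
   over [B] with the sum over its members that are nonnegative or in [A]. *)
Lemma unordered_sum_abs_bounded {R : realType} {I : choiceType} (T : I -> R) (L : R) :
  summability.partial_sum T @ summability.totally --> L ->
  exists C, forall B : {fset I}, \sum_(i <- B) `|T i| <= C.
Proof.
move=> cT; have [A hA] := unordered_sum_dist _ _ _ cT ltr01.
(* Both [Q] and [B] contain [A], so twice the sum over [Q] minus the sum over [B] is below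
   [2 * (L + 1) - (L - 1) = L + 3]. The last term corrects for the negative terms in [A]. *)
exists (L + 3 + 2 * \sum_(i <- A) `|T i|) => B0.
pose B := (A `|` B0)%fset.
have AB : (A `<=` B)%fset by exact: fsubsetUl.
have le0 : \sum_(i <- B0) `|T i| <= \sum_(i <- B) `|T i|.
  rewrite (fset_sum_subset B0 B); last exact: fsubsetUr.
  by apply: ler_sum => i _; case: ifP.
apply: le_trans le0 _.
pose Q := [fset i in B | (0 <= T i) || (i \in A)]%fset.
have AQ : (A `<=` Q)%fset.
  by apply/fsubsetP => i iA; rewrite !inE iA orbT.
have QE : \sum_(i <- Q) T i = \sum_(i <- B) (if (0 <= T i) || (i \in A) then T i else 0).
  by rewrite /Q -big_fset_condE big_mkcond.
have := hA _ AQ; have := hA _ AB; rewrite QE !ltr_norml => /andP[_ h1] /andP[h2 _].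
have : \sum_(i <- B) `|T i| <=
    2 * (\sum_(i <- B) (if (0 <= T i) || (i \in A) then T i else 0)) - \sum_(i <- B) T i
    + 2 * \sum_(i <- A) `|T i|.
  rewrite (fset_sum_subset A B) // !mulr_sumr -sumrB -big_split /=.
  apply: ler_sum => i _.
  have [Ti|Ti] := leP 0 (T i); have [iA|iA] := boolP (i \in A); rewrite /=.
  - by rewrite ger0_norm //; lra.
  - by rewrite ger0_norm //; lra.
  - by rewrite ltr0_norm //; lra.
  - by rewrite ltr0_norm //; lra.
lra.
Qed.

Lemma monomial_const {R : realType} {n : nat} (al : {ffun 'I_n -> nat}) (r : R) :
  monomial al (const_mx r) = \prod_(i < n) r ^+ al i.
Proof. by apply: eq_bigr => i _; rewrite mxE. Qed.

(** A nonconstant monomial has a coordinate with positive exponent, which supplies one factor [t];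
    the other powers of [t] are at most 1. *)
Lemma monomial_le {R : realType} {n : nat} (al : {ffun 'I_n -> nat}) (x : 'rV[R]_n) (t r : R) :
  0 <= t <= 1 -> 0 < r -> `|x| <= t * r -> al != [ffun=> 0%N] ->
  `|monomial al x| <= t * `|monomial al (const_mx r)|.
Proof.
move=> /andP[t0 t1] r0 xtr al0.
have xj j : `|x ord0 j| <= t * r.
  by apply: (proj1 (rV_norm_le _ _ _)) => //; rewrite mulr_ge0 // ltW.
have [j alj] : exists j, al j != 0%N.
  apply/existsP; apply: contraNT al0 => /existsPn H.
  by apply/eqP/ffunP => i; rewrite ffunE; have := H i; rewrite negbK => /eqP.
rewrite monomial_const /monomial !normr_prod (bigD1 j) //= [in leRHS](bigD1 j) //= mulrA.
have pw i : `|x ord0 i ^+ al i| <= t ^+ al i * `|r ^+ al i|.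
  rewrite !normrX (gtr0_norm r0) -exprMn; apply: lerXn2r => //.
  by rewrite nnegrE mulr_ge0 // ltW.
apply: ler_pM => //.
- by apply: prodr_ge0.
- apply: le_trans (pw j) _; apply: ler_wpM2r => //.
  by case: (al j) alj => // k _; rewrite exprS ler_piMr // exprn_ile1.
apply: ler_prod => i _; rewrite normr_ge0 /=; apply: le_trans (pw i) _.
by rewrite ler_piMl // exprn_ile1.
Qed.

(** The series converges absolutely at the corner [x + const_mx r], with bound [C]. By
    [monomial_le], at distance [t * r] from [x] its nonconstant part is at most [t * C]. *)
Lemma real_analytic_continuous {R : realType} {n : nat} (D : set 'rV[R]_n) (f : 'rV[R]_n -> R) x :
  real_analytic D f -> D x -> {for x, continuous f}.
Proof.
move=> af Dx; have [c] := af x Dx.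
move=> /nbhs_ballP[d /= d0 cP].
pose r := d / 2; have r0 : 0 < r by rewrite divr_gt0.
have ballP y : `|y - x| <= r -> ball x d y.
  by rewrite -ball_normE /= distrC => /le_lt_trans; apply; rewrite /r; lra.
have [C hC] : exists C, forall B : {fset {ffun 'I_n -> nat}},
    \sum_(al <- B) `|c al * monomial al (const_mx r)| <= C.
  apply: (unordered_sum_abs_bounded _ (f (x + const_mx r))).
  have := cP (x + const_mx r); rewrite addrAC subrr add0r; apply; apply: ballP.
  rewrite addrAC subrr add0r; apply: (proj2 (rV_norm_le _ _ (ltW r0))) => j.
  by rewrite mxE gtr0_norm.
pose z : {ffun 'I_n -> nat} := [ffun=> 0%N].
have mz y : monomial z y = 1 by rewrite /monomial big1 // => i _; rewrite ffunE.
have C0 : 0 <= C by have := hC fset0; rewrite big_seq_fset0.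
have key y t : 0 <= t <= 1 -> `|y - x| <= t * r -> `|f y - c z| <= t * C.
  move=> /andP[t0 t1] yt; apply/ler_addgt0Pl => e e0.
  have yr : `|y - x| <= r by apply: le_trans yt _; rewrite ler_piMl // ltW.
  have [A hA] := unordered_sum_dist _ _ _ (cP y (ballP _ yr)) e0.
  (* Adjoining the zero multi-index lets the constant term [c z] be split off. *)
  have := hA (z |` A)%fset (fsubsetU1 _ _).
  rewrite (big_fsetD1 z) ?fset1U1 //= mz mulr1.
  set s := \sum_(_ <- _) _ => fs.
  have : `|s| <= t * C.
    rewrite /s (le_trans (ler_norm_sum _ _ _)) //.
    apply: le_trans (ler_wpM2l t0 (hC ((z |` A) `\ z)%fset)).
    rewrite mulr_sumr big_seq [leRHS]big_seq; apply: ler_sum => al.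
    rewrite !inE => /andP[alz _].
    by rewrite !normrM mulrCA; apply: ler_wpM2l => //; apply: monomial_le => //; rewrite t0.
  have -> : f y - c z = (f y - (c z + s)) + s by ring.
  by move=> sC; rewrite (le_trans (ler_normD _ _)) // lerD // ltW.
have fx : f x = c z.
  apply/eqP; rewrite -subr_eq0 -normr_eq0 eq_le normr_ge0 andbT.
  by have := key x 0; rewrite lexx ler01 mul0r subrr normr0 lexx mul0r; apply.
apply: (proj2 (@cvgrPdist_le _ _ _ (nbhs x) (nbhs_filter x) f (f x))) => e e0.
apply/nbhs_ballP.
exists (r * Num.min 1 (e / (C + 1))) => [|y].
  by rewrite /= mulr_gt0 // lt_min ltr01 divr_gt0 // ltr_wpDl.
rewrite -ball_normE /= distrC => yx; rewrite fx distrC.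
set t := Num.min _ _ in yx.
have t0 : 0 <= t by rewrite le_min ler01 divr_ge0 ?ltW // ltr_wpDl.
apply: (@le_trans _ _ (t * C)).
  by apply: key; rewrite ?t0 ?ge_min ?lexx // mulrC ltW.
apply: (@le_trans _ _ (e / (C + 1) * C)).
  by apply: ler_wpM2r => //; rewrite ge_min lexx orbT.
by rewrite mulrAC ler_pdivrMr ?ltr_wpDl // ler_pM2l // lerDl.
Qed.

(** * The ratio of two harmonic functions *)

Section Ratio.
Context {R : realType} {n : nat}.
Context (Omega O : set 'rV[R]_n) (v : 'rV[R]_n -> R).
Context (n0 : (0 < n)%N) (oOm : open Omega) (cOm : connected Omega).
Context (hv : forall x, Omega x -> harmonic_at v x) (v0 : exists2 x, Omega x & v x != 0).
Context (oO : open O) (cO : compact (closure O)) (OOm : closure O `<=` Omega).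

(** Truncating to [max (f - c) 0 * v] lets the maximum principle run on all of [closure O], without
    describing the boundary of the superlevel set: the product is 0 where [f <= c], and near any
    other point, which must lie in [O], it equals [u - c v]. *)
Lemma ratio_le_of_boundary (u f : 'rV[R]_n -> R) (c : R) :
  (forall x, Omega x -> harmonic_at u x) -> (forall x, Omega x -> {for x, continuous f}) ->
  (forall x, Omega x -> u x = f x * v x) ->
  (forall y, boundary O y -> f y <= c) -> forall y, closure O y -> f y <= c.
Proof.
move=> hu cf uf fb y0 Ky0; rewrite leNgt; apply/negP => fy0.
have fcO y : closure O y -> c < f y -> O y.
  move=> Ky cfy; apply: contrapT => nOy; have := fb y; rewrite leNgt cfy.
  by move=> /(_ _)/negP; apply => //; split => // /interior_subset.
have nearf y : closure O y -> c < f y -> \forall t \near y, [/\ closure O t, c < f t & O t].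
  move=> Ky cfy; near=> t; have Ot : O t.
    by near: t; apply: open_nbhs_nbhs; split=> //; exact: fcO.
  split=> //; first exact: subset_closure.
  by near: t; apply: (@cvgr_gt _ _ (nbhs y) (nbhs_filter y) f (f y)) => //; exact: cf _ (OOm _ Ky).
(* The factor [s] is used with the values 1 and -1, so that the truncated product is both
   nonpositive and nonnegative. *)
have phi_le0 s y : closure O y -> s * (Num.max (f y - c) 0 * v y) <= 0.
  move: y; apply: harmonic_max_principle => // y Ky; have Oy := OOm _ Ky.
    apply: continuousM; first exact: cst_continuous.
    apply: continuousM; last by have [] := hv _ Oy.
    apply: continuous_max; last exact: cst_continuous.
    by apply: continuousB; [exact: cf|exact: cst_continuous].
  have [fc|fc] := leP (f y) c.
    by left; rewrite max_r ?subr_le0 // mul0r mulr0.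
  right; split.
    by move: (nearf y Ky fc); apply: filterS => t [].
  apply: (@harmonic_at_near _ _ (fun t => s * u t + (- (s * c)) * v t)); last first.
    by apply: harmonic_at_lin; [exact: hu|exact: hv].
  move: (nearf y Ky fc); apply: filterS => t [Kt ct _].
  rewrite max_l ?subr_ge0 ?(ltW ct) // uf; last exact: OOm.
  by ring.
have [x Ox] := v0; apply/negP; rewrite negbK; apply/eqP.
apply: (@harmonic_unique_continuation _ _ Omega v y0) => //; first exact: OOm.
move: (nearf y0 Ky0 fy0); apply: filterS => t [Kt ct _].
have := phi_le0 1 t Kt; have := phi_le0 (-1) t Kt.
rewrite max_l ?subr_ge0 ?(ltW ct) // => h1 h2.
have /eqP : (f t - c) * v t = 0 by lra.
by rewrite mulf_eq0 subr_eq0 gt_eqF //= => /eqP.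
Unshelve. all: by end_near. Qed.

Context (O0 : O !=set0).

Lemma ratio_max_on_boundary (u f : 'rV[R]_n -> R) :
  (forall x, Omega x -> harmonic_at u x) -> (forall x, Omega x -> {for x, continuous f}) ->
  (forall x, Omega x -> u x = f x * v x) ->
  exists2 p, boundary O p & forall y, closure O y -> f y <= f p.
Proof.
move=> hu cf uf.
have bK : boundary O `<=` closure O by move=> y [].
have cb : compact (boundary O).
  apply: subclosed_compact cO bK; apply: closedI; first exact: closed_closure.
  exact/open_closedC/open_interior.
(* With an empty boundary every [c] would be an upper bound vacuously; [c = f y - 1] is absurd. *)
have b0 : boundary O !=set0.
  apply: contrapT => /set0P/negP; rewrite negbK => /eqP b0.
  have [y Oy] := O0.
  have := @ratio_le_of_boundary u f (f y - 1) hu cf uf _ y (@subset_closure _ O y Oy).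
  rewrite b0 => /(_ (fun _ => @False_ind _)); lra.
have [p /set_mem bp hp] : exists2 p, p \in boundary O & forall t, t \in boundary O -> f t <= f p.
  apply: EVT_max_rV => //; apply: continuous_in_subspaceT => y /set_mem /bK /OOm; exact: cf.
by exists p => //; exact: (ratio_le_of_boundary _ _ _ hu cf uf (fun y yb => hp y (mem_set yb))).
Qed.

End Ratio.

Theorem theorem2p7 (R : realType) (n : nat) (hn : (2 <= n)%N)
    (Omega : set 'rV[R]_n) (hOmega : domain Omega)
    (u v : 'rV[R]_n -> R)
    (hu : is_harmonic Omega u) (hv : is_harmonic Omega v)
    (hv0 : exists2 x, Omega x & v x != 0)
    (hZ : zero_set Omega v `<=` zero_set Omega u)
    (f : 'rV[R]_n -> R) (hf : real_analytic Omega f)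
    (huf : forall x, Omega x -> u x = f x * v x)
    (O : set 'rV[R]_n) (hO : domain O) (hOc : compactly_contained O Omega) :
  (exists M, is_max_on f (boundary O) M /\ is_max_on f (closure O) M) /\
  (exists m, is_min_on f (boundary O) m /\ is_min_on f (closure O) m).
Proof.
have n0 : (0 < n)%N := ltnW hn.
have [oOm cOm _] := hOmega; have [oO _ O0] := hO; have [cO OOm] := hOc.
have hu' x : Omega x -> harmonic_at u x by exact: is_harmonic_at.
have hv' x : Omega x -> harmonic_at v x by exact: is_harmonic_at.
have cf x : Omega x -> {for x, continuous f} by exact: real_analytic_continuous.
have bK y : boundary O y -> closure O y by case.
split.
  have [p bp hp] := ratio_max_on_boundary _ _ _ n0 oOm cOm hv' hv0 oO cO OOm O0 _ _ hu' cf huf.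
  exists (f p); split; split; try by exists p => //; exact: bK.
    by move=> _ [y yb <-]; apply: hp; exact: bK.
  by move=> _ [y yb <-]; exact: hp.
(* The minimum of [f] is the maximum of [- f], the ratio of [- u] to [v]; [- u] is written as a
   linear combination to fit [harmonic_at_lin]. *)
have hNu x : Omega x -> harmonic_at (fun y => 0 * u y + -1 * u y) x.
  by move=> Ox; apply: harmonic_at_lin; exact: hu'.
have cNf x : Omega x -> {for x, continuous (fun y => - f y)}.
  by move=> Ox; apply: continuousN; exact: cf.
have [|p bp hp] := ratio_max_on_boundary _ _ _ n0 oOm cOm hv' hv0 oO cO OOm O0 _ _ hNu cNf.
  by move=> x Ox; rewrite huf //; ring.
exists (f p); split; split; try by exists p => //; exact: bK.
  by move=> _ [y yb <-]; rewrite -lerN2; apply: hp; exact: bK.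
by move=> _ [y yb <-]; rewrite -lerN2; exact: hp.
Qed.
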